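(* Let $f : [0,1] \to \mathbb{R}$ be a continuous function. For each integer $n \geq 1$ define the polynomial $$F_n(x) = \sum_{m=0}^{n} \frac{f(m/n)}{n+1} \sum_{j=m+1}^{n+1} p_{j,n+1}(x), \qquad \text{where } p_{j,n+1}(x) = \binom{n+1}{j} x^{j} (1-x)^{n+1-j}.$$ Then the sequence of polynomials $F_1, F_2, F_3, \ldots$ converges uniformly on $[0,1]$ to a continuous function $F : [0,1] \to \mathbb{R}$ which is differentiable on the open interval $(0,1)$ and satisfies $F'(x) = f(x)$ for all $x \in (0,1)$.
   Context: All functions are real-valued. Uniform convergence on $[0,1]$ is with respect to the supremum norm $\|g\| = \sup\{|g(x)| : x \in [0,1]\}$ for bounded functions $g$ on $[0,1]$. *)

(* Defs.v *)
From mathcomp Require Import all_boot all_order all_algebra.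
From mathcomp Require Import all_classical all_reals all_analysis.
Set Implicit Arguments.
Unset Strict Implicit.
Unset Printing Implicit Defensive.
Import Order.TTheory GRing.Theory Num.Theory.
Local Open Scope ring_scope.

Definition bernstein_poly (R : realType) (j n : nat) : {poly R} :=
  'C(n, j)%:R *: ('X^j * (1 - 'X) ^+ (n - j)).

(* At n = 0 the node m / n is 0 / 0 = 0 and the value carries no meaning;
   only n >= 1 is intended. *)
Definition approx_primitive (R : realType) (f : R -> R) (n : nat) : {poly R} :=
  \sum_(0 <= m < n.+1)
    (f (m%:R / n%:R) / n.+1%:R) *:
      \sum_(m.+1 <= j < n.+2) bernstein_poly R j n.+1.

(* Main.v *)
Require Import Defs.
From mathcomp Require Import all_boot all_order all_algebra.
From mathcomp Require Import all_classical all_reals all_analysis.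
From mathcomp Require Import ring lra.
Set Implicit Arguments.
Unset Strict Implicit.
Unset Printing Implicit Defensive.
Import Order.TTheory GRing.Theory Num.Theory.
Import numFieldNormedType.Exports.
Local Open Scope classical_set_scope.
Local Open Scope ring_scope.

(** The polynomial [approx_primitive f n] is the primitive, vanishing at 0, of
    the [n]-th Bernstein polynomial of [f]: differentiating a tail sum of
    Bernstein basis polynomials of degree [n + 1] telescopes to [n + 1] times a
    single basis polynomial of degree [n] ([deriv_approx_primitive]).

    The Bernstein polynomials of [f] converge to [f] uniformly on [[0, 1]]
    ([bernstein_uniform_approx], Bernstein's proof of the Weierstrass theorem).
    Compactness gives, for every [e > 0], a constant [C] such that
    [|f t - f x| <= e + C (t - x)^2] for all [t] and [x] in [[0, 1]]; averaging
    this over the binomial weights and using the binomial variance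
    [n x (1 - x)] bounds the error at [x] by [e + C x (1 - x) / n].

    Let [F] be the primitive [x |-> int_0^x f].  The difference between
    [approx_primitive f n] and [F] vanishes at 0 and its derivative is the
    Bernstein error, so the mean value theorem bounds that difference on
    [[0, 1]] by the supremum of the Bernstein error
    ([approx_primitive_error]). *)

(** * Bernstein basis polynomials and their derivatives *)

Section Bernstein.
Context {R : realType}.
Implicit Types (g h : nat -> R) (f : R -> R) (x a c : R).

Lemma bernstein_poly_small (j n : nat) : (n < j)%N -> bernstein_poly R j n = 0.
Proof. by move=> nj; rewrite /bernstein_poly bin_small// scale0r. Qed.

Lemma bernstein_poly0S (n : nat) :
  bernstein_poly R 0 n.+1 = (1 - 'X) * bernstein_poly R 0 n.
Proof. by rewrite /bernstein_poly !bin0 !scale1r !expr0 !mul1r !subn0 exprS. Qed.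

Lemma bernstein_polySS (m n : nat) :
  bernstein_poly R m.+1 n.+1 =
  'X * bernstein_poly R m n + (1 - 'X) * bernstein_poly R m.+1 n.
Proof.
rewrite /bernstein_poly subSS binS natrD scalerDl addrC -!scalerAr.
congr (_ *: _ + _); first by rewrite mulrA exprS.
have [mn|nm] := ltnP m n; last by rewrite bin_small// !scale0r.
by rewrite -(subnSK mn) [(1 - 'X) ^+ _.+1]exprS mulrCA.
Qed.

Lemma bernstein_poly_ge0 (j n : nat) x :
  0 <= x <= 1 -> 0 <= (bernstein_poly R j n).[x].
Proof.
move=> /andP[x0 x1]; rewrite /bernstein_poly !hornerE.
by apply: mulr_ge0; [apply: mulr_ge0|]; rewrite ?exprn_ge0 ?subr_ge0.
Qed.

(** The product rule gives two terms; the absorption identities for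
    ['C(n.+1, k.+1)] extract the common factor [n.+1] from both. *)
Lemma deriv_bernstein_polyS (k n : nat) :
  (bernstein_poly R k.+1 n.+1)^`() =
  n.+1%:R *: (bernstein_poly R k n - bernstein_poly R k.+1 n).
Proof.
have E1 : ('C(n.+1, k.+1)%:R : R) * k.+1%:R = n.+1%:R * 'C(n, k)%:R.
  by rewrite -!natrM mulnC -mul_bin_diag.
have E2 : ('C(n.+1, k.+1)%:R : R) * (n - k)%:R = n.+1%:R * 'C(n, k.+1)%:R.
  by rewrite -!natrM (mul_bin_down n.+1) subSS mulnC.
rewrite /bernstein_poly subSS derivZ derivM derivXn /= deriv_exp derivB derivX.
rewrite derivC sub0r scalerDr scalerBr !scalerA -E1 -E2 -!scalerA subnS.
by rewrite !scaler_nat mulrnAl mulN1r mulNrn mulrN mulrnAr mulNrn.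
Qed.

(** By [deriv_bernstein_polyS] the derivatives telescope; the upper end term
    is [bernstein_poly n.+1 n], which is zero because ['C(n, n.+1) = 0]. *)
Lemma deriv_bernstein_tail (m n : nat) : (m <= n)%N ->
  (\sum_(m.+1 <= j < n.+2) bernstein_poly R j n.+1)^`() =
  n.+1%:R *: bernstein_poly R m n.
Proof.
move=> mn; rewrite big_add1 /= linear_sum /=.
under eq_bigr do rewrite deriv_bernstein_polyS.
rewrite -scaler_sumr; congr (_ *: _).
rewrite -[LHS]opprK -sumrN.
under eq_bigr do rewrite opprB.
rewrite telescope_sumr; last exact: leqW.
by rewrite bernstein_poly_small// sub0r opprK.
Qed.

Lemma deriv_approx_primitive f (n : nat) :
  (approx_primitive f n)^`() =
  \sum_(0 <= m < n.+1) f (m%:R / n%:R) *: bernstein_poly R m n.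
Proof.
rewrite /approx_primitive linear_sum /=; apply: eq_big_nat => m /andP[_ mn].
by rewrite derivZ deriv_bernstein_tail// scalerA divfK ?pnatr_eq0.
Qed.

Lemma approx_primitive_at0 f (n : nat) : (approx_primitive f n).[0] = 0.
Proof.
rewrite /approx_primitive horner_sum big1// => m _.
rewrite hornerZ horner_sum big_add1 big1 ?mulr0// => j _.
by rewrite /bernstein_poly !hornerE expr0n /= !(mul0r, mulr0).
Qed.

(** * Binomial averages *)

(** The expectation of [g] under the binomial law with [n] trials of success
    probability [x]; for [g m = f (m / n)] it is the value at [x] of the
    Bernstein polynomial of [f]. *)
Definition bernstein_mean g (n : nat) x : R :=
  \sum_(0 <= m < n.+1) g m * (bernstein_poly R m n).[x].

(** Conditioning on the outcome of one trial.  The total mass and the second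
    moments follow by induction on [n]. *)
Lemma bernstein_meanS g (n : nat) x :
  bernstein_mean g n.+1 x =
  x * bernstein_mean (g \o succn) n x + (1 - x) * bernstein_mean g n x.
Proof.
have X1E : (1 - 'X : {poly R}).[x] = 1 - x by rewrite !hornerE.
rewrite /bernstein_mean big_nat_recl// bernstein_poly0S.
under eq_bigr do rewrite bernstein_polySS hornerD mulrDr.
rewrite big_split /= addrCA; congr (_ + _).
  by rewrite mulr_sumr; apply: eq_bigr => i _; rewrite hornerM hornerX mulrCA.
rewrite [in LHS]big_nat_recr//= (bernstein_poly_small (ltnSn n)).
rewrite mulr0 horner0 mulr0 addr0.
rewrite [in RHS]big_nat_recl// mulrDr mulr_sumr; congr (_ + _).
  by rewrite hornerM X1E mulrCA.
by apply: eq_bigr => i _; rewrite hornerM X1E mulrCA.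
Qed.

Lemma bernstein_mean0 g x : bernstein_mean g 0 x = g 0%N.
Proof.
rewrite /bernstein_mean big_nat1 /bernstein_poly bin0 scale1r.
by rewrite !expr0 mulr1 hornerE mulr1.
Qed.

Lemma bernstein_mean_cst c (n : nat) x : bernstein_mean (fun=> c) n x = c.
Proof.
elim: n => [|n IHn]; first by rewrite bernstein_mean0.
by rewrite bernstein_meanS [_ \o _]/comp IHn; ring.
Qed.

(** Variance plus squared bias.  The centre [a] is arbitrary because the
    induction step moves it to [a - 1]. *)
Lemma bernstein_mean_sqr a (n : nat) x :
  bernstein_mean (fun m => (m%:R - a) ^+ 2) n x =
  n%:R * (x * (1 - x)) + (n%:R * x - a) ^+ 2.
Proof.
elim: n a => [|n IHn] a; first by rewrite bernstein_mean0; ring.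
rewrite bernstein_meanS IHn.
have -> : (fun m : nat => (m%:R - a) ^+ 2) \o succn =
          (fun m : nat => (m%:R - (a - 1)) ^+ 2).
  by apply: funext => m /=; rewrite -natr1; ring.
by rewrite IHn -natr1; ring.
Qed.

Lemma bernstein_mean_dist_le g h c (n : nat) x : 0 <= x <= 1 ->
    (forall m, (m <= n)%N -> `|g m - c| <= h m) ->
  `|bernstein_mean g n x - c| <= bernstein_mean h n x.
Proof.
move=> x01 gh; rewrite -[c in leLHS](bernstein_mean_cst c n x).
rewrite /bernstein_mean -sumrB; apply: le_trans (ler_norm_sum _ _ _) _.
apply: ler_sum_nat => m /andP[_ mn].
have b0 := bernstein_poly_ge0 m n x01.
by rewrite -mulrBl normrM (ger0_norm b0) ler_wpM2r// gh.
Qed.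

End Bernstein.

(** * Uniform convergence of the Bernstein polynomials *)

Section Convergence.
Context {R : realType}.
Implicit Types (f F : R -> R) (x : R).

(** For [t] close to [x] continuity makes [e] alone sufficient; for [t]
    far from [x] the quadratic term exceeds twice a bound of [|f|] once [C] is
    large.  Both are obtained in one pass, by covering [K] with neighbourhoods
    on which every large [C] works.  The quadratic form is the one that
    averages explicitly over binomial weights. *)
Lemma within_continuous_quadratic_bound f (K : set R) (e : R) :
    compact K -> {within K, continuous f} -> 0 < e ->
  exists2 C : R, 0 <= C &
    forall x t, K x -> K t -> `|f t - f x| <= e + C * (t - x) ^+ 2.
Proof.
move=> cK cf e0.
have [M M0 fM] : exists2 M : R, 0 <= M & forall x, K x -> `|f x| <= M.
  have [M [_ fM]] := compact_bounded (continuous_compact cf cK).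
  exists (Num.max (M + 1) 0); first by rewrite le_max lexx orbT.
  move=> x Kx; apply: fM; last by exists x.
  by rewrite lt_max ltrDl ltr01.
have : \forall C \near +oo, K `<=` [set x |
    forall t, K t -> `|f t - f x| <= e + C * (t - x) ^+ 2].
  apply: (iffRL (near_covering_withinP K) ((compact_near_coveringP K).1 cK)).
  move=> x0 Kx0.
  have /cvgrPdist_lt /(_ (e / 2)) := (subspace_continuousP K f).1 cf x0 Kx0.
  rewrite divr_gt0// => /(_ isT); rewrite near_withinE => -[d /= d0 fd].
  have {}fd s : K s -> `|s - x0| < d -> `|f s - f x0| < e / 2.
    by move=> Ks sx0; rewrite distrC; apply: fd => //=; rewrite distrC.
  (* If [|x - x0| < d / 2] and [|t - x0| >= d], then [|t - x| >= d / 2], and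
     the threshold on [C] gives [C (t - x)^2 >= 2 M >= |f t - f x|]. *)
  exists ([set x | `|x - x0| < d / 2], [set C | 8 * M / d ^+ 2 <= C]).
    split => /=; last by apply: nbhs_pinfty_ge; rewrite num_real.
    exists (d / 2) => /=; first by rewrite divr_gt0.
    by move=> x /=; rewrite distrC.
  case=> x C [/= xx0 MC] Kx t Kt.
  have C0 : 0 <= C.
    by apply: le_trans MC; apply: divr_ge0; rewrite ?sqr_ge0//; lra.
  have [tx0|tx0] := ltP `|t - x0| d.
    have h1 := fd t Kt tx0.
    have h2 : `|f x - f x0| < e / 2 by apply: fd => //; lra.
    have h3 : 0 <= C * (t - x) ^+ 2 by rewrite mulr_ge0 ?sqr_ge0.
    have := ler_distD (f x0) (f t) (f x); rewrite (distrC (f x0)) => h4.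
    lra.
  have h1 : d / 2 <= `|t - x|.
    by have := ler_distD x t x0; lra.
  have h2 : (d / 2) ^+ 2 <= (t - x) ^+ 2.
    by rewrite -[leRHS]real_normK ?num_real// lerXn2r ?nnegrE// divr_ge0// ltW.
  have h3 : 2 * M <= C * (t - x) ^+ 2.
    apply: le_trans (ler_wpM2l C0 h2).
    apply: le_trans (ler_wpM2r (sqr_ge0 _) MC).
    suff -> : 8 * M / d ^+ 2 * (d / 2) ^+ 2 = 2 * M by [].
    by field; rewrite gt_eqF.
  have := ler_normB (f t) (f x); have := fM _ Kt; have := fM _ Kx; lra.
move=> [C [_ KC]]; exists (Num.max (C + 1) 0).
  by rewrite le_max lexx orbT.
by move=> x t Kx Kt; apply: KC => //; rewrite lt_max ltrDl ltr01.
Qed.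

Lemma bernstein_uniform_approx f (e : R) :
    {within `[0, 1], continuous f} -> 0 < e ->
  \forall n \near \oo, forall x, 0 <= x <= 1 ->
    `|bernstein_mean (fun m => f (m%:R / n%:R)) n x - f x| <= e.
Proof.
move=> cf e0.
have e20 : 0 < e / 2 by rewrite divr_gt0.
have [C C0 fC] :=
  within_continuous_quadratic_bound (@segment_compact _ 0 1) cf e20.
near=> n => x x01.
have n0 : (0 < n)%N by near: n; exact: nbhs_infty_gt.
have n0R : (0 : R) < n%:R by rewrite ltr0n.
have Cn : C / n%:R <= e / 2.
  rewrite ler_pdivrMr// mulrC -ler_pdivrMr//.
  by near: n; exact: nbhs_infty_ger.
(* [q m] is the quadratic bound at [t = m / n], with [n ^ 2] moved out of the
   square so that its average is given by [bernstein_mean_sqr]. *)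
pose q (m : nat) : R := e / 2 + C / n%:R ^+ 2 * (m%:R - n%:R * x) ^+ 2.
have fq m : (m <= n)%N -> `|f (m%:R / n%:R) - f x| <= q m.
  move=> mn.
  have -> : q m = e / 2 + C * (m%:R / n%:R - x) ^+ 2.
    by rewrite /q; field; rewrite gt_eqF.
  apply: fC; rewrite /= in_itv//=.
  by rewrite divr_ge0//= ler_pdivrMr// mul1r ler_nat.
have qe : bernstein_mean q n x <= e.
  have -> : bernstein_mean q n x =
      e / 2 + C / n%:R ^+ 2 * (n%:R * (x * (1 - x))).
    rewrite -[e / 2 in RHS](bernstein_mean_cst _ n x).
    have -> : n%:R * (x * (1 - x)) =
        bernstein_mean (fun m => (m%:R - n%:R * x) ^+ 2) n x.
      by rewrite bernstein_mean_sqr; ring.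
    rewrite /bernstein_mean mulr_sumr -big_split /=.
    by apply: eq_bigr => m _; rewrite /q; ring.
  have -> : C / n%:R ^+ 2 * (n%:R * (x * (1 - x))) = C / n%:R * (x * (1 - x)).
    by field; rewrite gt_eqF.
  have x1 : x * (1 - x) <= 1 by nra.
  have := ler_wpM2l (divr_ge0 C0 (ltW n0R)) x1; lra.
exact: le_trans (bernstein_mean_dist_le x01 fq) qe.
Unshelve. all: by end_near. Qed.

(** * Primitives and the mean value bound *)

(** The integrand is [f] cut off outside [[a, b]]: continuity of [f] within
    [[a, b]] gives integrability there and continuity of the cut-off at every
    interior point, which the fundamental theorem of calculus requires. *)
Lemma exists_primitive f (a b : R) : a < b ->
    {within `[a, b], continuous f} ->
  exists F, [/\ F a = 0, {within `[a, b], continuous F} &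
    forall x, a < x < b -> is_derive x 1 F (f x)].
Proof.
move=> ab cf.
pose fab := f \_ `[a, b].
have ifab : lebesgue_measure.-integrable `[a, b] (EFin \o fab).
  rewrite -restrict_EFin; apply/integrable_restrict => //=; rewrite setIid.
  by apply: continuous_compact_integrable => //; exact: segment_compact.
exists (fun x => parameterized_integral lebesgue_measure a x fab); split.
- by rewrite /parameterized_integral set_itv1 Rintegral_set1.
- by apply: parameterized_integral_continuous => //; exact: ltW.
- move=> x /andP[ax xb].
  have xab : x \in `]a, b[ by rewrite in_itv/= ax xb.
  have fabx : fab x = f x.
    by rewrite /fab patchE mem_set//=; exact: subset_itv_oo_cc.
  have cfab : {for x, continuous fab}.
    rewrite /prop_for /continuous_at fabx.
    by apply: cvg_patch => //; exact: cf.
  have [dF F'] := continuous_FTC1_closed xb ifab ax cfab.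
  by rewrite -fabx -F' derive1E; exact: derivableP.
Qed.

Lemma norm_le_of_is_derive (g g' : R -> R) (a b e : R) :
    {within `[a, b], continuous g} -> g a = 0 ->
    (forall x, a < x < b -> is_derive x 1 g (g' x)) ->
    (forall x, a < x < b -> `|g' x| <= e) ->
  forall x, a <= x <= b -> `|g x| <= e * (x - a).
Proof.
move=> cg ga dg g'e x /andP[]; rewrite le_eqVlt => /predU1P[<- _|ax xb].
  by rewrite ga normr0 subrr mulr0.
have sub y : y \in `]a, x[ -> a < y < b.
  by rewrite in_itv/= => /andP[-> yx]; rewrite (lt_le_trans yx).
have cgx : {within `[a, x], continuous g}.
  by apply: continuous_subspaceW cg; apply: subset_itvl; rewrite bnd_simp.
have [c cax] := MVT ax (fun y yax => dg y (sub y yax)) cgx.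
rewrite ga subr0 => ->; rewrite normrM (gtr0_norm (_ : 0 < x - a)) ?subr_gt0//.
by rewrite ler_wpM2r ?subr_ge0 ?(ltW ax)// g'e// sub.
Qed.

(** The error hypothesis is on the Bernstein polynomial of [f], which is the
    derivative of [approx_primitive f n]; integrating over an interval of length
    at most 1 does not increase the bound. *)
Lemma approx_primitive_error f F (n : nat) (e : R) :
    F 0 = 0 -> {within `[0, 1], continuous F} ->
    (forall x, 0 < x < 1 -> is_derive x 1 F (f x)) ->
    (forall x, 0 <= x <= 1 ->
      `|bernstein_mean (fun m => f (m%:R / n%:R)) n x - f x| <= e) ->
  forall x, 0 <= x <= 1 -> `|(approx_primitive f n).[x] - F x| <= e.
Proof.
move=> F0 cF dF Be x /[dup] x01 /andP[x0 x1].
have e0 : 0 <= e by apply: le_trans (Be x x01).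
pose P := approx_primitive f n.
have P'E y : P^`().[y] = bernstein_mean (fun m => f (m%:R / n%:R)) n y.
  rewrite deriv_approx_primitive horner_sum.
  by apply: eq_bigr => m _; rewrite hornerZ.
apply: (@le_trans _ _ (e * (x - 0))); last by rewrite subr0 ler_piMr.
apply: (@norm_le_of_is_derive (horner P - F)
  (fun y => bernstein_mean (fun m => f (m%:R / n%:R)) n y - f y) 0 1) => //.
- move=> y; apply: continuousB; last exact: cF.
  by apply: continuous_subspaceT => z; exact: continuous_horner.
- by rewrite -[LHS]/(P.[0] - F 0) F0 approx_primitive_at0 subrr.
- move=> y y01; rewrite -P'E.
  by apply: is_deriveB; exact: dF.
- by move=> y /andP[y0 y1]; apply: Be; rewrite !ltW.
Qed.

Lemma uniform_cvg_le (A : set R) (u : nat -> R -> R) F :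
  (forall e : R, 0 < e ->
    \forall n \near \oo, forall x, A x -> `|u n x - F x| <= e) ->
  {uniform A, u @ \oo --> F}.
Proof.
move=> uF P /uniform_nbhs[E [entE EP]].
move: entE; rewrite -entourage_ballE => -[e /= e0 eE].
have e20 : 0 < e / 2 by rewrite divr_gt0.
apply: filterS (uF _ e20) => n un; apply: EP => x Ax; apply: eE => /=.
rewrite /ball /= distrC (le_lt_trans (un x Ax))//.
by rewrite ltr_pdivrMr// ltr_pMr// ltr1n.
Qed.

End Convergence.

Theorem mainTheorem1 (R : realType) (f : R -> R)
    (f_cont : {within `[0, 1], continuous f}) :
  exists F : R -> R,
    [/\ {uniform `[0, 1],
          (fun (n : nat) (x : R) => (approx_primitive f n.+1).[x]) @ \oo --> F},
        {within `[0, 1], continuous F} &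
        forall x : R, 0 < x < 1 -> derivable F x 1 /\ F^`()%classic x = f x].
Proof.
have [F [F0 cF dF]] := exists_primitive ltr01 f_cont.
exists F; split=> //; last first.
  by move=> x /dF F'; split; [exact: ex_derive|rewrite derive1E derive_val].
apply: uniform_cvg_le => e e0.
have [N _ NP] := bernstein_uniform_approx f_cont e0.
exists N => // n /= Nn x; rewrite in_itv/= => x01.
exact: (approx_primitive_error F0 cF dF (NP n.+1 (leqW Nn))).
Qed.
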